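(* Let $R$ be an integral domain with field of fractions $K$, let $D$ be a ring with $R\subseteq D\subseteq K$, let $\ast_1$ be a star operation on $R$ and $\ast_2$ a star operation on $D$. Assume that the extension $R\subseteq D$ is $(\ast_1,\ast_2)$-compatible and that $R$ is Clifford $\ast_1$-regular (respectively, Boole $\ast_1$-regular, $\ast_1$-stable, strongly $\ast_1$-stable). Assume also that one of the following conditions holds: (a) $D$ is flat over $R$ (for example $D$ is a ring of fractions of $R$); (b) $D$ is a fractional overring of $R$ (i.e. $D$ is a fractional ideal of $R$); (c) each ideal of $D$ is $\ast_2$-finite. Then $D$ is Clifford $\ast_2$-regular (respectively, Boole $\ast_2$-regular, $\ast_2$-stable, strongly $\ast_2$-stable).
   Context: For an integral domain $R$ with field of fractions $K$, an ideal means a nonzero fractional ideal; $\mathcal F(R)$ is the set of ideals; $(J:I)=\{x\in K: xI\subseteq J\}$. A star operation on $R$ is a map $\mathcal F(R)\to\mathcal F(R)$, $I\mapsto I^\ast$, such that for all $0\ne a\in K$ and $I,J\in\mathcal F(R)$: $R^\ast=R$ and $(aI)^\ast=aI^\ast$; $I\subseteq I^\ast$, and $I\subseteq J$ implies $I^\ast\subseteq J^\ast$; $I^{\ast\ast}=I^\ast$. An ideal $I$ is $\ast$-finite if $I^\ast=J^\ast$ for some finitely generated ideal $J$. $R$ is Clifford $\ast$-regular if for every ideal $I$ there is an ideal $J$ of $R$ with $I^\ast=(I^2J)^\ast$; Boole $\ast$-regular if for every ideal $I$ there is $0\ne x\in K$ with $(I^2)^\ast=xI^\ast$; $\ast$-stable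 if for every ideal $I$, with $E:=(I^\ast:I^\ast)$, one has $(I^\ast(E:I^\ast))^\ast=E$; strongly $\ast$-stable if for every ideal $I$, $I^\ast$ is a principal ideal of $(I^\ast:I^\ast)$. $R\subseteq D$ is $(\ast_1,\ast_2)$-compatible if $(ID)^{\ast_2}=(I^{\ast_1}D)^{\ast_2}$ for every ideal $I$ of $R$. *)

(* Defs.v *)
From HB Require Import structures.
From mathcomp Require Import all_boot all_order all_algebra.
From mathcomp Require Import boolp classical_sets.

Set Implicit Arguments.
Unset Strict Implicit.
Unset Printing Implicit Defensive.

Import GRing.Theory.
Local Open Scope classical_set_scope.
Local Open Scope ring_scope.

(* Flat modules *)

(* A list [:: (a1, m1); ...; (an, mn)] stands for the element
   a1 (x) m1 + ... + an (x) mn of the tensor product A (x)_S M.  By the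
   universal property of A (x)_S M, two such sums are equal in it if and only
   if they have the same image under the map A (x)_S M -> P induced by every
   bilinear map A x M -> P. *)
Definition tensor_eq (S : comNzRingType) (A M : lmodType S)
    (s t : seq (A * M)) : Prop :=
  forall (P : lmodType S) (phi : {bilinear A -> M -> P}),
    \sum_(p <- s) phi p.1 p.2 = \sum_(p <- t) phi p.1 p.2.

(* For every injective S-linear f : A -> B, the map
   f (x) id : A (x)_S M -> B (x)_S M is injective. *)
Definition flat (S : comNzRingType) (M : lmodType S) : Prop :=
  forall (A B : lmodType S) (f : {linear A -> B}), injective f ->
  forall s t : seq (A * M),
    tensor_eq [seq (f p.1, p.2) | p <- s] [seq (f p.1, p.2) | p <- t] ->
    tensor_eq s t.

(* Subrings of a field, as rings and as modules over smaller subrings *)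

Section SubringType.
Variables (K : fieldType) (S : subringClosed K).

Record subring_type := SubringType {
  subring_val : K;
  subring_valP : subring_val \in S }.

HB.instance Definition _ := [isSub for subring_val].
HB.instance Definition _ := [Choice of subring_type by <:].
HB.instance Definition _ := [SubChoice_isSubComNzRing of subring_type by <:].

End SubringType.

Section OverringModule.
Variables (K : fieldType) (R D : subringClosed K) (RD : {subset R <= D}).

(* D with R acting by multiplication in K; the alias records the inclusion on
   which this action depends. *)
Definition overring_module & {subset R <= D} : Type := subring_type D.

HB.instance Definition _ := GRing.Zmodule.on (overring_module RD).

Definition overring_scale (r : subring_type R) (x : overring_module RD) :
    overring_module RD :=
  SubringType (RD (subring_valP r)) * (x : subring_type D).

Fact overring_scaleA a b x :
  overring_scale a (overring_scale b x) = overring_scale (a * b) x.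
Proof. by apply: val_inj; rewrite /= mulrA. Qed.

Fact overring_scale1 : left_id 1 overring_scale.
Proof. by move=> x; apply: val_inj; rewrite /= mul1r. Qed.

Fact overring_scaleDr : right_distributive overring_scale +%R.
Proof. by move=> a x y; apply: val_inj; rewrite /= mulrDr. Qed.

Fact overring_scaleDl x : {morph overring_scale^~ x : a b / a + b}.
Proof. by move=> a b; apply: val_inj; rewrite /= mulrDl. Qed.

HB.instance Definition _ :=
  GRing.Zmodule_isLmodule.Build (subring_type R) (overring_module RD)
    overring_scaleA overring_scale1 overring_scaleDr overring_scaleDl.

End OverringModule.

Section Ideals.
Variable K : fieldType.
Implicit Types (S R D : subringClosed K) (I J : set K) (star : set K -> set K).

Definition has_fraction_field S : Prop :=
  forall x : K, exists a b : K, [/\ a \in S, b \in S, b != 0 & x = a / b].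

(* Fractional ideals *)

Definition submodule S I : Prop :=
  [/\ I 0, forall x y, I x -> I y -> I (x + y)
    & forall a x, a \in S -> I x -> I (a * x)].

(* "Ideal" means nonzero fractional ideal throughout. *)
Definition ideal S I : Prop :=
  [/\ submodule S I, exists2 x, I x & x != 0
    & exists d : K, [/\ d \in S, d != 0 & forall x, I x -> d * x \in S]].

(* Finite sums of products x y with x in I and y in J *)
Definition idmul I J : set K :=
  [set x | exists2 s : seq (K * K),
     (forall p, p \in s -> I p.1 /\ J p.2) & x = \sum_(p <- s) p.1 * p.2].

Definition colon J I : set K := [set x | forall y, I y -> J (x * y)].

Definition scale (a : K) I : set K := [set a * x | x in I].

Definition finitely_generated S I : Prop :=
  exists s : seq K, I = idmul [set` S] [set` s].

(* Star operations *)

(* A map on the ideals of S is represented by a function on all subsets of K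
   whose values outside the ideals of S are irrelevant. *)
Record star_operation S star : Prop := StarOperation {
  star_ideal : forall I, ideal S I -> ideal S (star I);
  star_ring : star [set` S] = [set` S];
  star_scale : forall a I, a != 0 -> ideal S I ->
    star (scale a I) = scale a (star I);
  star_sub : forall I, ideal S I -> I `<=` star I;
  star_mono : forall I J, ideal S I -> ideal S J -> I `<=` J ->
    star I `<=` star J;
  star_idem : forall I, ideal S I -> star (star I) = star I }.

Definition star_finite S star I : Prop :=
  exists J, [/\ ideal S J, finitely_generated S J & star I = star J].

Definition Clifford_regular S star : Prop :=
  forall I, ideal S I ->
    exists2 J, ideal S J & star I = star (idmul (idmul I I) J).

Definition Boole_regular S star : Prop :=
  forall I, ideal S I ->
    exists2 x : K, x != 0 & star (idmul I I) = scale x (star I).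

Definition stable S star : Prop :=
  forall I, ideal S I ->
    let E := colon (star I) (star I) in
    star (idmul (star I) (colon E (star I))) = E.

(* Principal ideals of (I^* : I^* ) are taken in the fractional sense, so the
   generator is an element of K. *)
Definition strongly_stable S star : Prop :=
  forall I, ideal S I ->
    exists2 x : K, x != 0 &
      star I = scale x (colon (star I) (star I)).

Definition compatible R D star1 star2 : Prop :=
  forall I, ideal R I ->
    star2 (idmul I [set` D]) = star2 (idmul (star1 I) [set` D]).

End Ideals.

(* Main.v *)
Require Import Defs.
From HB Require Import structures.
From mathcomp Require Import all_boot all_order all_algebra.
From mathcomp Require Import boolp classical_sets.

(* Under each of (a), (b), (c), every ideal J of D satisfies J^{*2} = (ID)^{*2}
   for some ideal I of R; compatibility then carries the equations that express
   regularity or stability of I over to J.  In case (a), write y in J, with J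
   contained in D, as y = a/b.  By flatness, the relation a.1 = b.y puts 1 in
   (R : y)D, so y lies in (J /\ R)D. *)

Set Implicit Arguments.
Unset Strict Implicit.
Unset Printing Implicit Defensive.

Import GRing.Theory.
Local Open Scope quotient_scope.
Local Open Scope classical_set_scope.
Local Open Scope ring_scope.

(** * Quotients of modules by submodules *)

Section QuotientModule.
Variables (S : comNzRingType) (M : lmodType S).
Variables (N : {pred M}) (subN : submod_closed N).

Let zmodN : zmodClosed M :=
  HB.pack N (GRing.isZmodClosed.Build M N (GRing.submod_closedB subN)).

Definition quotient_module : Type := Quotient.quot zmodN.
HB.instance Definition _ := GRing.Zmodule.on quotient_module.

Definition quotient_pi (m : M) : quotient_module := \pi_(Quotient.quot zmodN) m.

Lemma quotient_pi_eq m n :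
  (quotient_pi m = quotient_pi n) <-> (m - n \in zmodN).
Proof. by rewrite Quotient.idealrBE; split=> /eqP. Qed.

Lemma quotient_piD : {morph quotient_pi : m n / m + n}.
Proof. exact: (raddfD (\pi_(Quotient.quot zmodN))). Qed.

(** Scaling goes through a chosen representative; [quotient_piZ] shows that the choice does not
    matter. *)
Definition quotient_scale (a : S) (u : quotient_module) : quotient_module :=
  quotient_pi (a *: repr u).

Lemma quotient_piZ a m :
  quotient_pi (a *: m) = quotient_scale a (quotient_pi m).
Proof.
apply/quotient_pi_eq; rewrite -scalerBr -[_ *: _]addr0.
have [N0 N1] := subN; apply: N1 => //; apply/quotient_pi_eq.
by rewrite /quotient_pi reprK.
Qed.

Fact quotient_scaleA a b u :
  quotient_scale a (quotient_scale b u) = quotient_scale (a * b) u.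
Proof. by rewrite -quotient_piZ scalerA. Qed.

Fact quotient_scale1 : left_id 1 quotient_scale.
Proof. by move=> u; rewrite /quotient_scale scale1r /quotient_pi reprK. Qed.

Fact quotient_scaleDr : right_distributive quotient_scale +%R.
Proof.
move=> a u v; rewrite -[u]reprK -[v]reprK -!/(quotient_pi _).
by rewrite -quotient_piD -!quotient_piZ scalerDr quotient_piD.
Qed.

Fact quotient_scaleDl u : {morph quotient_scale^~ u : a b / a + b}.
Proof. by move=> a b; rewrite /quotient_scale scalerDl quotient_piD. Qed.

HB.instance Definition _ :=
  GRing.Zmodule_isLmodule.Build S quotient_module
    quotient_scaleA quotient_scale1 quotient_scaleDr quotient_scaleDl.

End QuotientModule.

(** * Flatness and the colon ideal (bS : a) *)

Section FlatColon.
Variables (S : comNzRingType) (a b : S).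

Definition ideal2 : {pred S^o} :=
  [pred u | `[< exists r s : S, u = r * a + s * b >]].

Fact ideal2_submod_closed : submod_closed ideal2.
Proof.
split=> [|c u v /asboolP[r [s ->]] /asboolP[r' [s' ->]]]; apply/asboolP.
  by exists 0, 0; rewrite !mul0r addr0.
exists (c * r + r'), (c * s + s').
by rewrite /GRing.scale /= mulrDr !mulrDl !mulrA addrACA.
Qed.

HB.instance Definition _ := GRing.isSubmodClosed.Build S S^o ideal2
  ideal2_submod_closed.

Record ideal2_type := Ideal2 { ideal2_val : S^o; _ : ideal2_val \in ideal2 }.
HB.instance Definition _ := [isSub for ideal2_val].
HB.instance Definition _ := [Choice of ideal2_type by <:].
HB.instance Definition _ := [SubChoice_isSubLmodule of ideal2_type by <:].

Lemma ideal2_coefP (u : ideal2_type) :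
  exists r, exists s, val u = r * a + s * b.
Proof. by have /asboolP := valP u. Qed.

(** A chosen coefficient of [a] in [u]; [u] determines it only modulo (bS : a). *)
Definition ideal2_coef (u : ideal2_type) : S := projT1 (cid (ideal2_coefP u)).

Variable M : lmodType S.

(* The submodule (bS : a)M *)
Definition colon_span : {pred M} :=
  [pred m | `[< exists2 s : seq (S * M),
     (forall p, p \in s -> exists c, p.1 * a = c * b)
     & m = \sum_(p <- s) p.1 *: p.2 >]].

Fact colon_span_submod_closed : submod_closed colon_span.
Proof.
split=> [|c u v /asboolP[s sP ->] /asboolP[t tP ->]]; apply/asboolP.
  by exists [::]; rewrite ?big_nil.
exists ([seq (p.1, c *: p.2) | p <- s] ++ t).
  by move=> p; rewrite mem_cat => /orP[/mapP[q /sP ? ->]|/tP].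
rewrite big_cat big_map scaler_sumr; congr (_ + _).
by apply: eq_bigr => p _; rewrite !scalerA mulrC.
Qed.

Definition colon_map (u : ideal2_type) (m : M) :
    quotient_module colon_span_submod_closed :=
  quotient_pi colon_span_submod_closed (ideal2_coef u *: m).

(** If r a + s b = r' a + s' b, then (r' - r) a is a multiple of b, so r m and r' m differ by an
    element of (bS : a)M. *)
Lemma colon_mapE (u : ideal2_type) m r s :
  val u = r * a + s * b ->
  colon_map u m = quotient_pi colon_span_submod_closed (r *: m).
Proof.
rewrite /colon_map /ideal2_coef; case: cid => r' /= [s' ->] e.
apply/quotient_pi_eq; rewrite -scalerBl; apply/asboolP.
exists [:: (r' - r, m)]; last by rewrite big_seq1.
move=> _ /[!inE] /eqP -> /=; exists (s - s').
by apply/eqP; rewrite !mulrBl subr_eq addrAC [_ * b + _]addrC -e addrK.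
Qed.

Fact colon_map_bilinear :
  bilinear_for *:%R *:%R colon_map.
Proof.
split=> [m c u v|u c m n].
  have [r [s e]] := ideal2_coefP u; have [r' [s' e']] := ideal2_coefP v.
  rewrite (colon_mapE _ e) (colon_mapE _ e').
  (* Since any coefficient may be used, the one chosen for c u + v is replaced by the combination of
     those of u and v. *)
  rewrite (@colon_mapE _ _ (c * r + r') (c * s + s')).
    by rewrite scalerDl -scalerA quotient_piD quotient_piZ.
  by rewrite /= e e' /GRing.scale /= mulrDr !mulrDl !mulrA addrACA.
rewrite /colon_map scalerDr quotient_piD; congr (_ + _).
by rewrite scalerA mulrC -scalerA quotient_piZ.
Qed.

HB.instance Definition _ := bilinear_isBilinear.Build S ideal2_type M
  (quotient_module colon_span_submod_closed) *:%R *:%R colon_map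
  colon_map_bilinear.

(* The bilinear map (r a + s b, x) |-> r x mod (bS : a)M sends both sides of
   a (x) m = b (x) n, which holds in (aS + bS) (x) M by flatness, to m and 0. *)
Lemma flat_colon (m n : M) : flat M -> a *: m = b *: n -> m \in colon_span.
Proof.
move=> flatM eqmn.
have aI : (a : S^o) \in ideal2.
  by apply/asboolP; exists 1, 0; rewrite mul1r mul0r addr0.
have bI : (b : S^o) \in ideal2.
  by apply/asboolP; exists 0, 1; rewrite mul1r mul0r add0r.
(* In S (x) M one has c (x) x = 1 (x) c x, so a (x) m = 1 (x) a m = 1 (x) b n = b (x) n there. *)
have phi1 (P : lmodType S) (phi : {bilinear S^o -> M -> P}) c x :
    phi c x = phi 1 (c *: x).
  by rewrite -[c in LHS]mulr1 linearZl_LR linearZr_LR.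
have : tensor_eq [:: (Ideal2 aI, m)] [:: (Ideal2 bI, n)].
  apply: (flatM _ _ (val : {linear ideal2_type -> S^o}) val_inj) => P phi.
  by rewrite !big_seq1 /= phi1 eqmn -phi1.
move=> /(_ _ colon_map); rewrite !big_seq1 /=.
rewrite (@colon_mapE _ _ 1 0) ?mul1r ?mul0r ?addr0 //.
rewrite (@colon_mapE (Ideal2 bI) _ 0 1) ?mul1r ?mul0r ?add0r //.
by move/quotient_pi_eq; rewrite scale0r scale1r subr0.
Qed.

End FlatColon.

(** * Products, colons and multiples of fractional ideals *)

Section Idmul.
Variable K : fieldType.
Implicit Types (R S D : subringClosed K) (I J L : set K).

Definition add_closed I : Prop := I 0 /\ forall x y, I x -> I y -> I (x + y).

Lemma idmul_add_closed I J : add_closed (idmul I J).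
Proof.
split=> [|_ _ [s sP ->] [t tP ->]]; first by exists [::]; rewrite ?big_nil.
exists (s ++ t); last by rewrite big_cat.
by move=> p; rewrite mem_cat => /orP[/sP|/tP].
Qed.

Lemma mem_idmul I J x y : I x -> J y -> idmul I J (x * y).
Proof.
move=> Ix Jy; exists [:: (x, y)]; last by rewrite big_seq1.
by move=> p /[!inE] /eqP ->.
Qed.

(** Minimality of the product among additively closed sets; it reduces the inclusions below to a
    check on products x y. *)
Lemma idmul_sub I J L : add_closed L ->
  (forall x y, I x -> J y -> L (x * y)) -> idmul I J `<=` L.
Proof.
move=> [L0 LD] IJL _ [s sP ->]; rewrite big_seq.
by elim/big_ind: _ => // p /sP[Ip Jp]; apply: IJL.
Qed.

Lemma idmulS I I' J J' : I `<=` I' -> J `<=` J' -> idmul I J `<=` idmul I' J'.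
Proof.
move=> II JJ; apply: idmul_sub; first exact: idmul_add_closed.
by move=> x y /II Ix /JJ Jy; apply: mem_idmul.
Qed.

Lemma idmulC I J : idmul I J = idmul J I.
Proof.
by apply/seteqP; split; apply: idmul_sub; try exact: idmul_add_closed;
  move=> x y Ix Jy; rewrite mulrC; apply: mem_idmul.
Qed.

(** The adjunction between product and colon. *)
Lemma idmul_sub_colon I J L : add_closed L ->
  (I `<=` colon L J) <-> (idmul I J `<=` L).
Proof.
move=> addL; split=> [IL|IL x Ix y Jy]; last by apply/IL/mem_idmul.
by apply: idmul_sub => // x y /IL; apply.
Qed.

(** Lets [idmul_sub] verify on products alone that a denominator or an element of a colon sends a
    product where it should. *)
Lemma mul_preimage_add_closed a I :
  add_closed I -> add_closed [set x | I (a * x)].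
Proof.
move=> [I0 ID]; split=> [|x y /= Ix Iy] /=; first by rewrite mulr0.
by rewrite mulrDr; apply: ID.
Qed.

Lemma colon_add_closed I J : add_closed I -> add_closed (colon I J).
Proof.
move=> [I0 ID]; split=> [y _|x y xI yI z Jz]; first by rewrite mul0r.
by rewrite mulrDl; apply: ID; [apply: xI|apply: yI].
Qed.

Lemma idmulA I J L : idmul I (idmul J L) = idmul (idmul I J) L.
Proof.
have sub I' J' L' : idmul (idmul I' J') L' `<=` idmul I' (idmul J' L').
  have addL := idmul_add_closed I' (idmul J' L').
  (* Once L' is moved into a colon, the remaining product is again tested on x y. *)
  apply/idmul_sub_colon => //; apply: idmul_sub.
    exact: colon_add_closed.
  by move=> x y Ix Jy z Lz; rewrite -mulrA; do 2?apply: mem_idmul.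
apply/seteqP; split; last exact: sub.
(* Reversing the order of the three factors turns this inclusion into [sub]. *)
by rewrite idmulC (idmulC J) (idmulC (idmul I J)) (idmulC I); apply: sub.
Qed.

(** If I had no nonzero element, every product would vanish. This is how an ideal of R is seen to be
    nonzero from its extension to D. *)
Lemma idmul_neq0 I J :
  (exists2 x, idmul I J x & x != 0) -> exists2 x, I x & x != 0.
Proof.
move=> [x IJx x0]; apply: contrapT => I0; suff: [set 0] x by apply/eqP.
apply: idmul_sub IJx => [|u v Iu _];
  first by split=> // ? ? -> ->; rewrite addr0.
have [->|u0] := eqVneq u 0; first by rewrite mul0r.
by case: I0; exists u.
Qed.

Lemma submodule_add_closed S I : submodule S I -> add_closed I.
Proof. by case. Qed.

Lemma submodule_ring S : submodule S [set` S].
Proof. by split=> *; [apply: rpred0|apply: rpredD|apply: rpredM]. Qed.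

Lemma ring_add_closed S : add_closed [set` S].
Proof. exact/submodule_add_closed/submodule_ring. Qed.

Lemma submodule_idmul S I J : submodule S J -> submodule S (idmul I J).
Proof.
move=> [J0 JD JZ]; have [IJ0 IJD] := idmul_add_closed I J.
split=> // a x aS [s sP ->].
exists [seq (p.1, a * p.2) | p <- s].
  by move=> _ /mapP[p /sP[Ip Jp] ->]; split=> //; apply: JZ.
by rewrite big_map mulr_sumr; apply: eq_bigr => p _; rewrite mulrCA.
Qed.

Lemma idmul_ring S I : submodule S I -> idmul I [set` S] = I.
Proof.
move=> [I0 ID IZ]; apply/seteqP; split=> [|x Ix].
  by apply: idmul_sub => // x y Ix Sy; rewrite mulrC; apply: IZ.
by rewrite -[x]mulr1; apply: mem_idmul => //; apply: rpred1.
Qed.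

(** S = SS supplies one factor S for each of I and J. Extension thus respects products, so equations
    between ideals of R pass to D. *)
Lemma idmul_extension S I J :
  idmul (idmul I J) [set` S] = idmul (idmul I [set` S]) (idmul J [set` S]).
Proof.
rewrite -[in LHS](idmul_ring (submodule_ring S)) !idmulA; congr idmul.
by rewrite -!idmulA (idmulC J).
Qed.

Lemma ideal_submodule S I : ideal S I -> submodule S I.
Proof. by case. Qed.

Lemma ideal_idmul S I J : ideal S I -> ideal S J -> ideal S (idmul I J).
Proof.
move=> [_ [x Ix x0] [d [dS d0 dI]]] [subJ [y Jy y0] [e [eS e0 eJ]]].
split; first exact: submodule_idmul.
  by exists (x * y); [apply: mem_idmul|apply: mulf_neq0].
exists (d * e); split; rewrite ?rpredM ?mulf_neq0 // => z.
suff: idmul I J `<=` [set z | d * e * z \in S] by apply.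
apply: idmul_sub; first exact: mul_preimage_add_closed (ring_add_closed S).
by move=> u v Iu Jv /=; rewrite mulrACA rpredM ?dI ?eJ.
Qed.

Lemma ideal_extension R D I : {subset R <= D} -> ideal R I ->
  ideal D (idmul I [set` D]).
Proof.
move=> RD [_ [x Ix x0] [d [dR d0 dI]]]; split.
- exact/submodule_idmul/submodule_ring.
- by exists (x * 1); [apply: mem_idmul => //; apply: rpred1|rewrite mulr1].
exists d; split=> [||z]; [exact: RD|by []|].
suff: idmul I [set` D] `<=` [set z | d * z \in D] by apply.
apply: idmul_sub; first exact: mul_preimage_add_closed (ring_add_closed D).
by move=> u v Iu Dv /=; rewrite mulrA rpredM // RD ?dI.
Qed.

Lemma mem_colonl S I J a x :
  submodule S I -> a \in S -> colon I J x -> colon I J (a * x).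
Proof. by move=> [_ _ IZ] aS xI y Jy; rewrite -mulrA; apply/IZ/xI. Qed.

Lemma ideal_colon S I J : ideal S I -> ideal S J -> ideal S (colon I J).
Proof.
move=> [subI [x Ix x0] [d [dS d0 dI]]] [_ [y Jy y0] [e [eS e0 eJ]]].
have [C0 CD] := colon_add_closed J (submodule_add_closed subI).
split.
- by split=> // a z aS zC; apply: mem_colonl subI aS zC.
(* For z in J, e z lies in S, so x (e z) lies in I. *)
- exists (x * e); last exact: mulf_neq0.
  move=> z Jz; rewrite -mulrA mulrC; have [_ _ IZ] := subI.
  by apply: IZ => //; apply: eJ.
(* For z in the colon, z y lies in I, so d clears it; the factor e brings y, and hence the
   denominator, into S. *)
exists (d * (e * y)); split=> [||z zC].
- by rewrite rpredM ?eJ.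
- by rewrite !mulf_neq0.
have -> : d * (e * y) * z = e * (d * (z * y)).
  by rewrite -!mulrA mulrCA (mulrC y).
by rewrite rpredM // dI //; apply: zC.
Qed.

Lemma ideal_scale S I a : has_fraction_field S -> a != 0 -> ideal S I ->
  ideal S (scale a I).
Proof.
move=> /(_ a)[p [q [pS qS q0 aE]]] a0 [[I0 ID IZ] [x Ix x0] [d [dS d0 dI]]].
split; first split.
- by exists 0; rewrite ?mulr0.
- by move=> _ _ [u Iu <-] [v Iv <-]; exists (u + v); [apply: ID|rewrite mulrDr].
- by move=> b _ bS [u Iu <-]; exists (b * u); [apply: IZ|rewrite mulrCA].
- by exists (a * x); [exists x|apply: mulf_neq0].
(* q clears the fraction a = p / q, and d clears I. *)
exists (q * d); split=> [||_ [u Iu <-]]; [exact: rpredM|exact: mulf_neq0|].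
by rewrite mulrACA aE mulrC (mulrC q) divfK // rpredM // dI.
Qed.

Lemma idmul_scale a I J : idmul (scale a I) J = scale a (idmul I J).
Proof.
have [IJ0 IJD] := idmul_add_closed I J.
apply/seteqP; split=> [|_ [_ [s sP ->] <-]].
  apply: idmul_sub; first split=> [|_ _ [u Iu <-] [v Iv <-]].
  - by exists 0; rewrite ?mulr0.
  - by exists (u + v); [apply: IJD|rewrite mulrDr].
  move=> _ y [u Iu <-] Jy.
  by exists (u * y); [apply: mem_idmul|rewrite mulrA].
exists [seq (a * p.1, p.2) | p <- s].
  by move=> _ /mapP[p /sP[Ip Jp] ->]; split=> //; exists p.1.
by rewrite big_map mulr_sumr; apply: eq_bigr => p _; rewrite mulrA.
Qed.

Lemma scale_colon_sub a I J : I a -> scale a (colon J I) `<=` J.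
Proof. by move=> Ia _ [x xJ <-]; rewrite mulrC; apply: xJ. Qed.

End Idmul.

(** * Star closures of products and colons *)

Section StarOperation.
Variables (K : fieldType) (S : subringClosed K) (star : set K -> set K).
Hypotheses (SK : has_fraction_field S) (starP : star_operation S star).
Implicit Types I J L : set K.

Lemma star_le I J : ideal S I -> ideal S J ->
  I `<=` star J -> star I `<=` star J.
Proof.
move=> idI idJ IJ; rewrite -[X in _ `<=` X](star_idem starP idJ).
by apply: (star_mono starP) => //; apply: (star_ideal starP).
Qed.

(** For nonzero x, the closure of xI is x times that of I, so xI inside [star J] forces x [star I]
    inside it. The scaling axiom excludes x = 0, which is treated apart. *)
Lemma colon_star_sub I J x : ideal S I -> ideal S J ->
  (forall y, I y -> star J (x * y)) -> colon (star J) (star I) x.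
Proof.
move=> idI idJ xIJ; have [->|x0] := eqVneq x 0.
  move=> y _; rewrite mul0r.
  by have [[]] := star_ideal starP idJ.
have idxI := ideal_scale SK x0 idI.
move=> y Iy; apply: (star_le idxI idJ) => [_ [u /xIJ ? <-]//|].
by rewrite (star_scale starP) //; exists y.
Qed.

(** Each y in J sends I into IJ, hence sends [star I] into the closure of IJ by [colon_star_sub]. *)
Lemma star_idmul_starl I J : ideal S I -> ideal S J ->
  star (idmul (star I) J) = star (idmul I J).
Proof.
move=> idI idJ; have idI' := star_ideal starP idI.
have idIJ := ideal_idmul idI idJ; have idI'J := ideal_idmul idI' idJ.
apply/seteqP; split; last first.
  by apply: (star_mono starP) => //; apply: idmulS => //;
    apply: (star_sub starP).
apply: star_le => //; apply: idmul_sub => [|x y Ix Jy].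
  exact: (submodule_add_closed (ideal_submodule (star_ideal starP idIJ))).
rewrite mulrC; apply: (colon_star_sub idI idIJ _ Ix) => z Iz.
by rewrite mulrC; apply/(star_sub starP idIJ)/mem_idmul.
Qed.

Lemma star_idmul_eq I I' J J' :
  ideal S I -> ideal S I' -> ideal S J -> ideal S J' ->
  star I = star I' -> star J = star J' -> star (idmul I J) = star (idmul I' J').
Proof.
move=> idI idI' idJ idJ' eqI eqJ.
rewrite -star_idmul_starl // eqI star_idmul_starl // idmulC.
by rewrite -star_idmul_starl // eqJ star_idmul_starl // idmulC.
Qed.

(** Each y in [star J] sends the colon into [star I], hence also the closure of the colon. *)
Lemma star_colon_star I J : ideal S I -> ideal S J ->
  star (colon (star I) (star J)) = colon (star I) (star J).
Proof.
move=> idI idJ; have idI' := star_ideal starP idI.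
have idJ' := star_ideal starP idJ; have idC := ideal_colon idI' idJ'.
apply/seteqP; split; last exact: (star_sub starP).
move=> x Cx y Jy; rewrite mulrC.
apply: (colon_star_sub idC idI _ Cx) => z; rewrite mulrC; exact.
Qed.

End StarOperation.

(** * Ideals of D as extensions of ideals of R *)

Section Contraction.
Variables (K : fieldType) (R D : subringClosed K) (RD : {subset R <= D}).
Hypothesis RK : has_fraction_field R.
Implicit Types I J : set K.

Lemma has_fraction_field_overring : has_fraction_field D.
Proof. by move=> x; have [a [b [/RD ? /RD ? ? ->]]] := RK x; exists a, b. Qed.

Lemma submodule_overring I : submodule D I -> submodule R I.
Proof. by move=> [I0 ID IZ]; split=> // a x /RD; apply: IZ. Qed.

Lemma flat_contraction_extension J : flat (overring_module RD) ->
  submodule D J -> J `<=` [set` D] -> idmul (J `&` [set` R]) [set` D] = J.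
Proof.
move=> flatD subJ JD; have [J0 JDD JZ] := subJ.
apply/seteqP; split=> [|y Jy].
  by apply: idmul_sub => // x d [Jx _] Dd; rewrite mulrC; apply: JZ.
have [a [b [aR bR b0 yE]]] := RK y.
pose m : overring_module RD := (1 : subring_type D).
pose n : overring_module RD := SubringType (JD _ Jy).
have : SubringType aR *: m = SubringType bR *: n.
  by apply: val_inj => /=; rewrite mulr1 yE mulrC divfK.
move=> /(flat_colon flatD)/asboolP[s sP e].
have {}e : 1 = \sum_(p <- s) val p.1 * subring_val (p.2 : subring_type D).
  have := congr1 (fun u : overring_module RD => subring_val u) e.
  rewrite /= => ->.
  by elim: s {sP e} => [|p s IHs]; rewrite ?big_nil // !big_cons /= IHs.
(* Multiply the expression of 1 by y = a / b: from p.1 a = c b comes p.1 y = c, an element of both J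
   and R. *)
exists [seq (val p.1 * y, subring_val (p.2 : subring_type D)) | p <- s].
  move=> _ /mapP[p /sP[c /(congr1 val)/= pE] ->] /=.
  split; last exact: subring_valP.
  split; first by apply: JZ => //; apply/RD/subring_valP.
  by rewrite /= yE mulrA pE mulfK //; apply: subring_valP.
rewrite big_map -[LHS]mul1r e mulr_suml; apply: eq_bigr => p _ /=.
by rewrite mulrAC.
Qed.

(** A denominator d brings J into D; then dJ is the extension of its contraction, and dividing by d
    gives I. *)
Lemma ideal_contraction_flat J : flat (overring_module RD) -> ideal D J ->
  exists2 I, ideal R I & J = idmul I [set` D].
Proof.
move=> flatD [subJ [x Jx x0] [d [dD d0 dJ]]].
pose J0 := scale d J; have subJ0 : submodule D J0.
  have idJ : ideal D J by split=> //; [exists x|exists d].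
  exact: (ideal_submodule (ideal_scale has_fraction_field_overring d0 idJ)).
have J0D : J0 `<=` [set` D] by move=> _ [u /dJ ? <-].
have J0E := flat_contraction_extension flatD subJ0 J0D.
have idI0 : ideal R (J0 `&` [set` R]).
  (* The contraction lies in R, so 1 is a denominator. *)
  split; last by exists 1; split=> [||z [_ ?]];
    rewrite ?rpred1 ?oner_neq0 ?mul1r.
  - have [J00 J0A J0Z] := subJ0; split=> [|u v [? ?] [? ?]|a u aR [? ?]].
    + by split=> //; apply: rpred0.
    + by split; [apply: J0A|apply: rpredD].
    + by split; [apply: J0Z => //; apply: RD|apply: rpredM].
  apply: (@idmul_neq0 _ _ [set` D]); rewrite J0E.
  by exists (d * x); [exists x|apply: mulf_neq0].
exists (scale d^-1 (J0 `&` [set` R])).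
  by apply: ideal_scale => //; rewrite invr_eq0.
rewrite idmul_scale J0E; apply/seteqP; split=> [u Ju|_ [_ [u Ju <-] <-]].
  by exists (d * u); [exists u|rewrite mulKf].
by rewrite mulKf.
Qed.

Lemma ideal_contraction_fractional J : ideal R [set` D] -> ideal D J ->
  ideal R J.
Proof.
move=> [_ _ [d [dR d0 dD]]] [subJ J0 [e [eD e0 eJ]]].
split=> //; first exact: submodule_overring.
(* The denominator e of J lies only in D, but dD inside R puts both d e and d (e x) in R. *)
exists (d * e * d); split=> [||x Jx].
- by rewrite rpredM ?dD.
- by rewrite !mulf_neq0.
by rewrite mulrAC rpredM // -mulrA; apply/dD/eJ.
Qed.

Lemma common_denominator (s : seq K) :
  exists d, [/\ d \in R, d != 0 & forall x, x \in s -> d * x \in R].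
Proof.
elim: s => [|x s [d [dR d0 ds]]].
  by exists 1; rewrite rpred1 oner_neq0.
have [a [b [aR bR b0 xE]]] := RK x.
exists (d * b); split=> [||y]; [exact: rpredM|exact: mulf_neq0|rewrite inE].
case/predU1P=> [->|/ds dy]; first by rewrite xE -mulrA (mulrC b) divfK ?rpredM.
by rewrite mulrAC rpredM.
Qed.

(** I is spanned over R by the same generators; a common denominator of these makes it
    fractional. *)
Lemma ideal_contraction_fg J : ideal D J -> finitely_generated D J ->
  exists2 I, ideal R I & J = idmul I [set` D].
Proof.
move=> idJ [s JE].
have JIE : J = idmul (idmul [set` R] [set` s]) [set` D].
  rewrite idmulC idmulA idmul_ring //.
  exact/submodule_overring/submodule_ring.
exists (idmul [set` R] [set` s]) => //; split.
- by rewrite idmulC; apply/submodule_idmul/submodule_ring.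
- by apply: (@idmul_neq0 _ _ [set` D]); rewrite -JIE; case: idJ.
have [d [dR d0 ds]] := common_denominator s; exists d; split=> // x.
suff: idmul [set` R] [set` s] `<=` [set z | d * z \in R] by apply.
apply: idmul_sub; first exact: mul_preimage_add_closed (ring_add_closed R).
by move=> u v Ru sv /=; rewrite mulrCA rpredM ?ds.
Qed.

End Contraction.

(** * Transfer of regularity and stability from R to D *)

Section Transfer.
Variables (K : fieldType) (R D : subringClosed K).
Hypotheses (RK : has_fraction_field R) (RD : {subset R <= D}).
Variables star1 star2 : set K -> set K.
Hypotheses (star1P : star_operation R star1) (star2P : star_operation D star2).
Hypothesis comp12 : compatible R D star1 star2.
Implicit Types I J : set K.

Let DK : has_fraction_field D := has_fraction_field_overring RD RK.

Lemma star_extension_eq I I' : ideal R I -> ideal R I' -> star1 I = star1 I' ->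
  star2 (idmul I [set` D]) = star2 (idmul I' [set` D]).
Proof. by move=> idI idI' e; rewrite comp12 // e -comp12. Qed.

(** In the flat case J itself is an extension; in the fractional case J is already an ideal of R and
    JD = J; in the finite case a finitely generated ideal with the same closure is an extension. *)
Lemma star_extension_fractional_ideal J :
  [\/ flat (overring_module RD),
      ideal R [set` D]
    | forall I : set K, ideal D I -> star_finite D star2 I] ->
  ideal D J -> exists2 I, ideal R I & star2 J = star2 (idmul I [set` D]).
Proof.
move=> cases idJ; case: cases => [flatD|idD|finD].
- by have [I idI ->] := ideal_contraction_flat RK flatD idJ; exists I.
- exists J; first exact: ideal_contraction_fractional idD idJ.
  by rewrite (idmul_ring (ideal_submodule idJ)).
have [J' [idJ' fgJ' ->]] := finD _ idJ.
by have [I idI ->] := ideal_contraction_fg RD RK idJ' fgJ'; exists I.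
Qed.

Hypothesis liftD : forall J, ideal D J ->
  exists2 I, ideal R I & star2 J = star2 (idmul I [set` D]).

(** If L serves for I, then LD serves for J: the equation extends to D, and ID may be exchanged for
    J under the closure of a product. *)
Lemma Clifford_regular_overring :
  Clifford_regular R star1 -> Clifford_regular D star2.
Proof.
move=> reg J idJ; have [I idI JE] := liftD idJ.
have [L idL IE] := reg I idI.
have idID := ideal_extension RD idI; have idLD := ideal_extension RD idL.
have idII := ideal_idmul idI idI.
exists (idmul L [set` D]) => //.
rewrite JE (star_extension_eq idI (ideal_idmul idII idL) IE) !idmul_extension.
apply: (star_idmul_eq DK star2P) => //; try exact: ideal_idmul.
exact: (star_idmul_eq DK star2P).
Qed.

(** The same x serves for J: I^2 and xI have equal closures, hence so do their extensions to D. *)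
Lemma Boole_regular_overring : Boole_regular R star1 -> Boole_regular D star2.
Proof.
move=> reg J idJ; have [I idI JE] := liftD idJ.
have [x x0 IE] := reg I idI; exists x => //.
have idID := ideal_extension RD idI; have idxI := ideal_scale RK x0 idI.
rewrite (star_idmul_eq DK star2P idJ idID idJ idID JE JE) -idmul_extension.
rewrite (@star_extension_eq _ (scale x I)) //; last first.
- by rewrite IE (star_scale star1P).
- exact: ideal_idmul.
by rewrite idmul_scale (star_scale star2P) // -JE.
Qed.

(** By compatibility J is also the closure of [star1 I] D, which x maps into itself. *)
Lemma colon_star_extension I x : ideal R I ->
  colon (star1 I) (star1 I) x ->
  let J := star2 (idmul I [set` D]) in colon J J x.
Proof.
move=> idI xI /=; have idID := ideal_extension RD idI.
have idI' := star_ideal star1P idI; have idI'D := ideal_extension RD idI'.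
rewrite comp12 //; apply: (colon_star_sub DK star2P) => //.
move=> y IDy; apply: (star_sub star2P) => //; move: y IDy.
apply: idmul_sub => [|u v I'u Dv]; last first.
  by rewrite mulrA; apply: mem_idmul => //; apply: xI.
exact: mul_preimage_add_closed (idmul_add_closed _ _).
Qed.

Lemma strongly_stable_overring :
  strongly_stable R star1 -> strongly_stable D star2.
Proof.
move=> sst J idJ; have [I idI JE] := liftD idJ.
have [x x0 IE] := sst I idI; exists x => //.
have idI' := star_ideal star1P idI; have idI'D := ideal_extension RD idI'.
have idJ' := star_ideal star2P idJ; have idF := ideal_colon idJ' idJ'.
have starF := star_colon_star DK star2P idJ idJ.
have idxF := ideal_scale DK x0 idF.
have starxF : star2 (scale x (colon (star2 J) (star2 J)))
    = scale x (colon (star2 J) (star2 J)).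
  by rewrite (star_scale star2P) // starF.
(* For the reverse inclusion, 1 stabilizes [star1 I], so x lies in [star1 I] and thus in [star2 J],
   which absorbs its own colon. *)
apply/seteqP; split; last first.
  apply: scale_colon_sub; rewrite JE comp12 //; apply: (star_sub star2P) => //.
  rewrite -[x]mulr1; apply: mem_idmul; last exact: rpred1.
  by rewrite IE; exists 1; [move=> y; rewrite mul1r|rewrite mulr1].
(* Since x times the colon is closed, it suffices that it contains [star1 I] D; multipliers of
   [star1 I] are multipliers of [star2 J]. *)
rewrite [X in X `<=` _]JE comp12 // -[X in _ `<=` X]starxF.
apply: (star_le star2P) => //; rewrite starxF.
apply: idmul_sub => [|u d].
  exact: submodule_add_closed (ideal_submodule idxF).
have [[_ _ FZ] _ _] := idxF; move=> I'u Dd; rewrite mulrC; apply: FZ => //.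
move: I'u; rewrite IE => -[e eI <-]; exists e => //.
by have := colon_star_extension idI eI; rewrite -JE.
Qed.

Lemma stable_overring : stable R star1 -> stable D star2.
Proof.
move=> st J idJ /=; have [I idI JE] := liftD idJ.
have := st I idI => /=; set A := star1 I; set E := colon A A => AE.
set F := colon (star2 J) (star2 J).
have idA : ideal R A := star_ideal star1P idI.
have idE : ideal R E := ideal_colon idA idA.
have idB : ideal R (colon E A) := ideal_colon idE idA.
have idAB := ideal_idmul idA idB; have idABD := ideal_extension RD idAB.
have idAD := ideal_extension RD idA.
have idJ' := star_ideal star2P idJ.
have idF : ideal D F := ideal_colon idJ' idJ'.
have starF : star2 F = F := star_colon_star DK star2P idJ idJ.
have idG : ideal D (colon F (star2 J)) := ideal_colon idF idJ'.
have idJG := ideal_idmul idJ' idG; have idJG' := star_ideal star2P idJG.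
have JAE : star2 J = star2 (idmul A [set` D]) by rewrite JE comp12.
have [F0 FD FZ] := ideal_submodule idF.
have EF : E `<=` F.
  by move=> e eI; have := colon_star_extension idI eI; rewrite -JE.
have AJ : A `<=` star2 J.
  move=> a Aa; rewrite JAE; apply: (star_sub star2P) => //.
  by rewrite -[a]mulr1; apply: mem_idmul => //; apply: rpred1.
(* If b sends A into E, it sends AD into F; as F is closed, it sends [star2 J], the closure of AD,
   into F too. *)
have BG : colon E A `<=` colon F (star2 J).
  move=> b bAE; rewrite JAE -starF.
  apply: (colon_star_sub DK star2P) => // y ADy; rewrite starF; move: y ADy.
  apply: idmul_sub => [|u v Au Dv].
    exact: mul_preimage_add_closed (conj F0 FD).
  by rewrite mulrA mulrC; apply: FZ => //; apply/EF/bAE.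
(* The crux: A (E : A) D lies in the product on D, and by stability of I with compatibility its
   closure is that of ED, which contains 1. *)
have JG1 : star2 (idmul (star2 J) (colon F (star2 J))) 1.
  suff : star2 (idmul (idmul A (colon E A)) [set` D]) 1.
    apply: (star_mono star2P) => //.
    rewrite -(idmul_ring (ideal_submodule idJG)).
    by do 2!apply: idmulS => //.
  rewrite comp12 // AE; apply: (star_sub star2P).
    exact: ideal_extension RD idE.
  rewrite -[1]mulr1; apply: mem_idmul; last exact: rpred1.
  by move=> y; rewrite mul1r.
apply/seteqP; split.
  rewrite -[X in _ `<=` X]starF; apply: (star_le star2P) => //; rewrite starF.
  by apply: idmul_sub => [//|x y Jx Gy]; rewrite mulrC; apply: Gy.
(* Any f in F maps the product, hence its closure, into itself; applied to 1 this gives f. *)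
move=> f Ff; rewrite -[f]mulr1; move: 1 JG1.
apply: (colon_star_sub DK star2P) => // y JGy.
apply: (star_sub star2P) => //; move: y JGy.
apply: idmul_sub => [|u v Ju Gv].
  exact: mul_preimage_add_closed (idmul_add_closed _ _).
by rewrite mulrA; apply: mem_idmul => //; apply: Ff.
Qed.

End Transfer.

Theorem proposition2p5 (K : fieldType) (R D : subringClosed K)
    (RK : has_fraction_field R) (RD : {subset R <= D})
    (star1 star2 : set K -> set K)
    (star1P : star_operation R star1) (star2P : star_operation D star2)
    (comp12 : compatible R D star1 star2)
    (cases : [\/ flat (overring_module RD),
                 ideal R [set` D]
               | forall I : set K, ideal D I -> star_finite D star2 I]) :
  [/\ Clifford_regular R star1 -> Clifford_regular D star2,
      Boole_regular R star1 -> Boole_regular D star2,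
      stable R star1 -> stable D star2
    & strongly_stable R star1 -> strongly_stable D star2].
Proof.
have liftD := star_extension_fractional_ideal RK cases.
split.
- exact: Clifford_regular_overring liftD.
- exact: Boole_regular_overring liftD.
- exact: stable_overring liftD.
- exact: strongly_stable_overring liftD.
Qed.
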